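(* If $P$ is a uniform ANR with a basepoint $pt\in P$, then for each $n$ the iterated loop space $\Omega^n(P,pt)=U((S^n,pt),(P,pt))$ is a uniform ANR.
   Context: A uniform ANR is a metrizable uniform space $Y$ such that for every uniform embedding $i$ of $Y$ onto a closed subspace of a metrizable uniform space $Z$ there exists a uniformly continuous retraction onto $i(Y)$ of some uniform neighborhood of $i(Y)$ in $Z$ (a set containing an $\varepsilon$-neighborhood of $i(Y)$ for some $\varepsilon>0$). $S^n$ is the $n$-sphere with a basepoint also denoted $pt$. $U((S^n,pt),(P,pt))$ is the space of all (uniformly) continuous basepoint-preserving maps $S^n\to P$ with the uniformity of uniform convergence, i.e. induced by the metric $d(f,g)=\sup_{x}d(f(x),g(x))$, where $d$ is a bounded metric inducing the uniformity of $P$. *)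

(* Defs.v *)
From HB Require Import structures.
From mathcomp Require Import all_boot all_order all_algebra.
From mathcomp Require Import all_classical all_reals all_analysis.

Set Implicit Arguments.
Unset Strict Implicit.
Unset Printing Implicit Defensive.

Import Order.TTheory GRing.Theory Num.Theory.
Import numFieldTopology.Exports.

Local Open Scope classical_set_scope.
Local Open Scope ring_scope.

(* Below, a set [A : set X] of a uniform space, when used as a type, is
   [set_type A] with the uniformity induced by the inclusion into [X]. *)

Definition is_metric (R : realType) (X : Type) (d : X -> X -> R) : Prop :=
  [/\ forall x y, d x y = 0 <-> x = y,
      forall x y, d x y = d y x &
      forall x y z, d x z <= d x y + d y z].

(* [d] is a metric inducing the uniformity of [X]. *)
Definition metrizes (R : realType) (X : uniformType) (d : X -> X -> R) : Prop :=
  is_metric d /\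
  @entourage X = entourage_ (fun (x : X) (e : R) => [set y | d x y < e]).

Definition metrizable (R : realType) (X : uniformType) : Prop :=
  exists d : X -> X -> R, metrizes d.

(* As [f] is injective, [g] is the inverse of [f : X -> range f]. *)
Definition uniform_embedding (X Y : uniformType) (f : X -> Y) : Prop :=
  [/\ injective f, unif_continuous f &
      exists2 g : range f -> X,
        (forall y : range f, f (g y) = val y) & unif_continuous g].

Definition eps_neighborhood (R : realType) (Z : Type) (d : Z -> Z -> R)
    (A : set Z) (e : R) : set Z :=
  [set z | exists2 a, A a & d a z < e].

(* The notion does not depend on the metric [d] inducing the uniformity. *)
Definition uniform_neighborhood (R : realType) (Z : Type) (d : Z -> Z -> R)
    (A N : set Z) : Prop :=
  exists2 e : R, 0 < e & eps_neighborhood d A e `<=` N.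

Definition unif_continuous_retraction (Z : uniformType) (N A : set Z)
    (r : N -> A) : Prop :=
  unif_continuous r /\ forall z : N, A (val z) -> val (r z) = val z.

(* All real types are isomorphic, so [R] only fixes where metrics take their
   values. *)
Definition uniform_ANR (R : realType) (Y : uniformType) : Prop :=
  metrizable R Y /\
  forall (Z : uniformType) (d : Z -> Z -> R) (i : Y -> Z),
    metrizes d -> uniform_embedding i -> closed (range i) ->
    exists2 N : set Z, uniform_neighborhood d (range i) N &
      exists r : N -> range i, unif_continuous_retraction r.

(* The unit sphere of the Euclidean space R^(n+1). *)
Definition sphere (R : realType) (n : nat) : set 'rV[R]_n.+1 :=
  [set x | \sum_(i < n.+1) x ord0 i ^+ 2 = 1].
Arguments sphere : clear implicits.

(* [{uniform X -> P}] carries the uniformity of uniform convergence. *)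
Definition pointed_maps (X P : uniformType) (s : X) (pt : P) :
    set {uniform X -> P} :=
  [set f | unif_continuous (f : X -> P) /\ f s = pt].

Definition iterated_loop_space (R : realType) (n : nat) (s : sphere R n)
    (P : uniformType) (pt : P) : uniformType :=
  pointed_maps s pt.

(* Main.v *)
Require Import Defs.
From HB Require Import structures.
From mathcomp Require Import all_boot all_order all_algebra.
From mathcomp Require Import all_classical all_reals all_analysis.
From mathcomp Require Import lra.

Set Implicit Arguments.
Unset Strict Implicit.
Unset Printing Implicit Defensive.

Import Order.TTheory GRing.Theory Num.Theory.
Import numFieldTopology.Exports.

Local Open Scope classical_set_scope.
Local Open Scope ring_scope.

(** The sphere is replaced by an arbitrary metrizable X with a basepoint s: the
    pointed uniformly continuous maps X -> P form a uniform ANR.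

    Let A be a closed subset of a metric space Z, and F : A -> U(X, P) a
    uniformly continuous family of pointed maps, such as the inverse of a
    uniform embedding of U((X, s), (P, pt)) onto A.  Embed P isometrically in
    the functions P -> R by p |-> d(p, -), with d <= 1.  Then F becomes a
    bounded real function of (a, x, q), uniformly continuous in a uniformly in
    (x, q), and uniformly continuous in x uniformly in q for each a.  The
    second continuity is not uniform in a, so the extension of F to Z takes two
    steps.
    - Extend in the variable a by infimal convolution with a modulus of
      continuity (McShane).  The extension is uniformly continuous in z, but it
      may fail to be continuous in x when z is not in A.
    - Repair this by a Lipschitz retraction of the bounded functions of x onto
      the uniformly continuous ones (Lindenstrauss).  It is again an infimal
      convolution, now with the modulus of the function itself, from which the
      jump (the limit of the oscillation at scale 0) is subtracted first: then
      the modulus tends to 0 at 0 for every bounded function.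
    One construction [regularize] serves for both steps.  Subtracting the value
    at s and adding d(pt, -) makes the result pointed.

    It remains to return to P.  As P need not be complete, its image need not
    be closed among the functions P -> R, and the hypothesis on P does not
    apply to it there.  So one more real coordinate is added, and the ambient
    space is the collar of the functions that have a nonzero last coordinate or
    lie in the image of P at height 0.  There the image of P is closed, so a
    neighborhood of it retracts onto P ([collar_retraction]).  The extension of
    F is given the height d(z, A) d(x, s): this vanishes exactly when z is in A
    or x = s, and in both cases the other coordinates are those of a point of
    P.  So the extension lands in the collar ([collar_extension]); composing it
    with the retraction gives pointed maps X -> P for all z near A. *)

(** * Infima of real-valued families *)

Section Infimum.
Context {R : realType} {I : Type}.
Implicit Types (D : set I) (F G : I -> R).

Definition infimum D F : R := inf [set F i | i in D].

Lemma infimum_le D F m i :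
  (forall j, D j -> m <= F j) -> D i -> infimum D F <= F i.
Proof.
move=> mF Di; apply: ge_inf; last by exists i.
by exists m => _ [j Dj <-]; exact: mF.
Qed.

Lemma infimum_ge D F m :
  D !=set0 -> (forall j, D j -> m <= F j) -> m <= infimum D F.
Proof.
move=> [i Di] mF; apply: lb_le_inf; first by exists (F i), i.
by move=> _ [j Dj <-]; exact: mF.
Qed.

Lemma infimum_lt D F m :
  D !=set0 -> infimum D F < m -> exists2 i, D i & F i < m.
Proof.
move=> D0 Fm; apply: contrapT => nF; move: Fm; apply/negP; rewrite -leNgt.
apply: infimum_ge => // j Dj; rewrite leNgt; apply/negP => Fj.
by apply: nF; exists j.
Qed.

Lemma infimum_lip D F G m c :
  D !=set0 -> (forall i, D i -> m <= F i) ->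
  (forall i, D i -> F i <= G i + c) -> infimum D F <= infimum D G + c.
Proof.
move=> D0 mF FG; rewrite -lerBlDr; apply: infimum_ge => // i Di.
by rewrite lerBlDr (le_trans _ (FG i Di))//; exact: infimum_le mF Di.
Qed.

End Infimum.

(** * Regularization by infimal convolution *)

Section Regularization.
Context {R : realType} {Z Q : Type}.
Variables (d : Z -> Z -> R) (A : set Z).
Hypotheses (dmetric : is_metric d) (A0 : A !=set0).
Implicit Types (f g : Z -> Q -> R).

Let dxx x : d x x = 0. Proof. by case: dmetric => h _ _; apply/h. Qed.
Let dsym x y : d x y = d y x. Proof. by case: dmetric. Qed.
Let dtri x y z : d x z <= d x y + d y z. Proof. by case: dmetric. Qed.
Let d0 x y : 0 <= d x y.
Proof. by have := dtri x y x; rewrite dxx (dsym y x); lra. Qed.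

(** Functions of z carry a parameter q so that every estimate below is uniform
    in q. *)
Definition unit_valued f := forall a q, A a -> 0 <= f a q <= 1.

Definition equi_unif_continuous_on f := forall e, 0 < e -> exists2 s, 0 < s &
  forall a b, A a -> A b -> d a b <= s -> forall q, `|f a q - f b q| <= e.

(** A pair (s, c) stands for the bound c on the oscillation of f at scale s.
    Working with all such bounds avoids the supremum that defines the
    oscillation. *)
Definition osc_bound f : set (R * R) := [set sc | [/\ 0 < sc.1, 0 <= sc.2 &
  forall a b, A a -> A b -> d a b <= sc.1 ->
    forall q, `|f a q - f b q| <= sc.2]].

(** The limit of the oscillation of f as the scale tends to 0. *)
Definition jump f : R := infimum (osc_bound f) snd.

(** A concave modulus: as f takes values in an interval of length 1, the term
    t / s dominates the oscillation at all scales t > s, so before [jump f] is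
    subtracted every affine function in the infimum bounds the oscillation of
    f at scale t. *)
Definition modulus f (t : R) : R :=
  infimum (osc_bound f) (fun sc => sc.2 - jump f + t / sc.1).

Definition regularize f (z : Z) (q : Q) : R :=
  infimum A (fun a => f a q + modulus f (d z a)).

Lemma osc_bound_nonempty f : unit_valued f -> osc_bound f !=set0.
Proof.
move=> f01; exists (1, 1); split => //= a b Aa Ab _ q.
have /andP[? ?] := f01 a q Aa; have /andP[? ?] := f01 b q Ab.
by rewrite ler_norml; lra.
Qed.

Lemma jump_le f s c : osc_bound f (s, c) -> jump f <= c.
Proof. by move=> fsc; apply: (@infimum_le _ _ _ _ 0 _ _ fsc) => -[? ?] []. Qed.

Lemma modulus_term_ge0 f t : 0 <= t ->
  forall sc, osc_bound f sc -> 0 <= sc.2 - jump f + t / sc.1.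
Proof.
move=> t0 [s c] fsc; apply: addr_ge0; first by rewrite subr_ge0 (jump_le fsc).
by case: fsc => /= s0 _ _; rewrite divr_ge0// ltW.
Qed.

Lemma modulus_ge0 f t : unit_valued f -> 0 <= t -> 0 <= modulus f t.
Proof.
move=> f01 t0; apply: infimum_ge; first exact: osc_bound_nonempty.
exact: modulus_term_ge0.
Qed.

Lemma modulus_le f t s c : 0 <= t -> osc_bound f (s, c) ->
  modulus f t <= c - jump f + t / s.
Proof.
by move=> t0 fsc; exact: (infimum_le (modulus_term_ge0 t0) fsc).
Qed.

Lemma osc_bound_jump f e : unit_valued f -> 0 < e ->
  exists s c, osc_bound f (s, c) /\ c - jump f < e.
Proof.
move=> f01 e0; have [|[s c] fsc /= ce] := @infimum_lt R _ (osc_bound f) snd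
  (jump f + e) (osc_bound_nonempty f01); first by rewrite ltrDl.
by exists s, c; split => //; rewrite ltrBlDl.
Qed.

Lemma modulus0 f : unit_valued f -> modulus f 0 = 0.
Proof.
move=> f01; apply/eqP; rewrite eq_le modulus_ge0// andbT.
apply/ler_addgt0Pl => e e0; have [s [c [fsc ce]]] := osc_bound_jump f01 e0.
by rewrite addr0 (le_trans (modulus_le _ fsc))// mul0r addr0 ltW.
Qed.

(** Comparing a term of scale s with a fixed one of scale s0 through the larger
    of the two scales gives the estimate: enlarging s divides t by more, at the
    price of the small bound c0 - jump. *)
Lemma modulus_continuous f e : unit_valued f -> 0 < e ->
  exists2 s0, 0 < s0 & forall t t' u, 0 <= t -> 0 <= t' -> 0 <= u ->
    t' <= t + u -> modulus f t' <= modulus f t + (e + u / s0).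
Proof.
move=> f01 e0; have [s0 [c0 [fsc0 c0e]]] := osc_bound_jump f01 e0.
have s00 : 0 < s0 by case: fsc0.
exists s0 => // t t' u t0 t'0 u0 t'tu.
rewrite -lerBlDr; apply: infimum_ge; first exact: osc_bound_nonempty.
move=> [s c] fsc /=; have s_gt0 : 0 < s by case: fsc.
have jc := jump_le fsc; have jc0 := jump_le fsc0.
have t'D r : 0 < r -> t' / r <= t / r + u / r.
  by move=> r0; rewrite -mulrDl ler_wpM2r// invr_ge0 ltW.
rewrite lerBlDr.
have [ss0|s0s] := leP s s0.
- apply: le_trans (modulus_le t'0 fsc0) _; have := t'D _ s00.
  have : t / s0 <= t / s by rewrite ler_wpM2l// lef_pV2.
  lra.
- apply: le_trans (modulus_le t'0 fsc) _; have := t'D _ s_gt0.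
  have : u / s <= u / s0 by rewrite ler_wpM2l// lef_pV2// ltW.
  lra.
Qed.

Lemma regularize_term_ge0 f z q : unit_valued f ->
  forall a, A a -> 0 <= f a q + modulus f (d z a).
Proof.
move=> f01 a Aa; have /andP[? _] := f01 a q Aa.
by apply: addr_ge0 => //; exact: modulus_ge0.
Qed.

Lemma regularize_ge0 f z q : unit_valued f -> 0 <= regularize f z q.
Proof. by move=> f01; apply: infimum_ge => //; exact: regularize_term_ge0. Qed.

(** Unlike f itself, [modulus f] is always continuous at 0, because the jump has
    been removed; an infimum of translates inherits its continuity. *)
Lemma regularize_continuous f e : unit_valued f -> 0 < e ->
  exists2 s, 0 < s & forall x y, d x y <= s ->
    forall q, `|regularize f x q - regularize f y q| <= e.
Proof.
move=> f01 e0; have e20 : 0 < e / 2 by lra.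
have [s0 s00 ws0] := modulus_continuous f01 e20.
have sub x y q : d x y <= s0 * (e / 2) ->
    regularize f x q <= regularize f y q + e.
  move=> xys; apply: (infimum_lip A0 (m := 0)).
    by move=> a Aa; exact: regularize_term_ge0.
  move=> a Aa; rewrite -addrA lerD2l.
  have xya : d x a <= d y a + d x y by rewrite addrC.
  have := ws0 _ _ _ (d0 y a) (d0 x a) (d0 x y) xya.
  have : d x y / s0 <= e / 2 by rewrite ler_pdivrMr// mulrC.
  lra.
exists (s0 * (e / 2)); first exact: mulr_gt0.
move=> x y xys q; have := sub x y q xys.
rewrite dsym in xys; have := sub y x q xys.
by rewrite ler_norml; lra.
Qed.

Lemma jump_eq0 f : unit_valued f -> equi_unif_continuous_on f -> jump f = 0.
Proof.
move=> f01 fc; apply/eqP; rewrite eq_le andbC; apply/andP; split.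
  by apply: infimum_ge; [exact: osc_bound_nonempty | move=> [? ?] []].
apply/ler_addgt0Pl => e e0; have [s s0 fs] := fc e e0.
by rewrite addr0; apply: (@jump_le f s); split => //=; exact: ltW.
Qed.

(** Without a jump, [modulus f] bounds the oscillation of f, hence no term of the
    infimum at z is smaller than f z q, which is the term at z itself. *)
Lemma regularize_id f z q : unit_valued f -> equi_unif_continuous_on f ->
  A z -> regularize f z q = f z q.
Proof.
move=> f01 fc Az; apply/eqP; rewrite eq_le; apply/andP; split.
  apply: le_trans (infimum_le (regularize_term_ge0 z q f01) Az) _.
  by rewrite dxx modulus0// addr0.
apply: infimum_ge => // a Aa; rewrite -lerBlDl.
apply: infimum_ge; first exact: osc_bound_nonempty.
move=> [s c] [/= s0 c0 fsc]; rewrite jump_eq0// subr0.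
have := fsc _ _ Az Aa; have /andP[? ?] := f01 z q Az.
have /andP[? ?] := f01 a q Aa.
have [zas /(_ isT q)|sza _] := leP (d z a) s.
  have : 0 <= d z a / s by rewrite divr_ge0// ltW.
  by rewrite ler_norml; lra.
have : 1 <= d z a / s by rewrite ler_pdivlMr// mul1r ltW.
lra.
Qed.

(** Moving f by c moves its oscillation and its jump by 2 c, its modulus by 4 c,
    and its regularization by 5 c. *)
Lemma osc_bound_close f g c : 0 <= c ->
  (forall a q, A a -> `|f a q - g a q| <= c) ->
  forall s b, osc_bound g (s, b) -> osc_bound f (s, b + 2 * c).
Proof.
move=> c0 fg s b [/= s0 b0 gsb]; split => //=; first lra.
move=> x y Ax Ay xy q; have := gsb x y Ax Ay xy q.
have := fg x q Ax; have := fg y q Ay; rewrite !ler_norml; lra.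
Qed.

Lemma jump_close f g c : unit_valued f -> unit_valued g -> 0 <= c ->
  (forall a q, A a -> `|f a q - g a q| <= c) -> jump f <= jump g + 2 * c.
Proof.
move=> f01 g01 c0 fg; rewrite -lerBlDr.
apply: infimum_ge; first exact: osc_bound_nonempty.
move=> [s b] gsb /=; rewrite lerBlDr; apply: (@jump_le f s).
exact: osc_bound_close gsb.
Qed.

Lemma modulus_close f g c t : unit_valued f -> unit_valued g -> 0 <= c ->
  0 <= t -> (forall a q, A a -> `|f a q - g a q| <= c) ->
  modulus f t <= modulus g t + 4 * c.
Proof.
move=> f01 g01 c0 t0 fg; rewrite -lerBlDr.
apply: infimum_ge; first exact: osc_bound_nonempty.
move=> [s b] gsb /=; rewrite lerBlDr.
apply: le_trans (modulus_le t0 (osc_bound_close c0 fg gsb)) _.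
have : jump g <= jump f + 2 * c.
  by apply: jump_close => // a q Aa; rewrite distrC; exact: fg.
lra.
Qed.

Lemma regularize_lip f g c : unit_valued f -> unit_valued g -> 0 <= c ->
  (forall a q, A a -> `|f a q - g a q| <= c) ->
  forall z q, `|regularize f z q - regularize g z q| <= 5 * c.
Proof.
have sub f' g' : unit_valued f' -> unit_valued g' -> 0 <= c ->
    (forall a q, A a -> `|f' a q - g' a q| <= c) ->
    forall z q, regularize f' z q <= regularize g' z q + 5 * c.
  move=> f01 g01 c0 fg z q; apply: (infimum_lip A0 (m := 0)).
    by move=> a Aa; exact: regularize_term_ge0.
  move=> a Aa; have := modulus_close f01 g01 c0 (d0 z a) fg.
  by have := fg a q Aa; rewrite ler_norml; lra.
move=> f01 g01 c0 fg z q; have := sub f g f01 g01 c0 fg z q.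
have : forall a q, A a -> `|g a q - f a q| <= c.
  by move=> a p Aa; rewrite distrC; exact: fg.
by move=> /(sub g f g01 f01 c0)/(_ z q); rewrite ler_norml; lra.
Qed.

End Regularization.

(** * Metrizable uniformities in terms of epsilon and delta *)

Section Metrics.
Context {R : realType}.

Lemma metric_xx (X : Type) (d : X -> X -> R) x : is_metric d -> d x x = 0.
Proof. by case=> d0 _ _; exact/d0. Qed.

Lemma metric_ge0 (X : Type) (d : X -> X -> R) x y : is_metric d -> 0 <= d x y.
Proof.
move=> dm; case: (dm) => _ dsym dtri; have := dtri x y x.
by rewrite (metric_xx x dm) (dsym y x); lra.
Qed.

Definition unif_cont_on (X Y : Type) (dX : X -> X -> R) (dY : Y -> Y -> R)
    (A : set X) (f : X -> Y) : Prop :=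
  forall e, 0 < e -> exists2 s, 0 < s &
    forall x y, A x -> A y -> dX x y <= s -> dY (f x) (f y) <= e.

Lemma metrizes_entourageP (X : uniformType) (d : X -> X -> R) E :
  metrizes d ->
  entourage E <-> exists2 e, 0 < e & forall x y, d x y < e -> E (x, y).
Proof.
case=> _ ->; split=> -[e e0 dE]; exists e => //; first by move=> x y /(dE (x, y)).
by move=> [x y] /dE.
Qed.

Lemma metrizes_unif_continuousP (X Y : uniformType) (dX : X -> X -> R)
    (dY : Y -> Y -> R) (f : X -> Y) : metrizes dX -> metrizes dY ->
  unif_continuous f <-> unif_cont_on dX dY setT f.
Proof.
move=> mX mY; split=> fc.
  move=> e e0; have /fc : entourage [set xy | dY xy.1 xy.2 < e].
    by apply/(metrizes_entourageP _ mY); exists e.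
  move=> /(metrizes_entourageP _ mX)[s s0 sf]; exists (s / 2); first lra.
  move=> x y _ _ xys; apply/ltW; apply: (sf x y); lra.
move=> E /(metrizes_entourageP _ mY)[e e0 eE].
have [|s s0 sf] := fc (e / 2); first lra.
apply/(metrizes_entourageP _ mX); exists s => // x y /ltW xys.
by apply: eE; have := sf x y I I xys; lra.
Qed.

Lemma metrizes_set_type (X : uniformType) (d : X -> X -> R) (A : set X) :
  metrizes d -> metrizes (fun x y : (A : Type) => d (val x) (val y)).
Proof.
move=> md; have [[d0 dsym dtri] _] := md; split.
  split=> [x y|x y|x y z]; [|exact: dsym|exact: dtri].
  by split=> [/d0/val_inj//|->]; exact/d0.
apply/seteqP; split => E.
- move=> [F /(metrizes_entourageP _ md)[e e0 eF] FE]; exists e => //.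
  by move=> [x y] /= /eF; exact: (FE (x, y)).
- move=> [e e0 eE]; exists [set xy | d xy.1 xy.2 < e].
    by apply/(metrizes_entourageP _ md); exists e.
  by move=> [x y]; exact: eE.
Qed.

(** Metrics bounded by 1 make distances to points [unit_valued] and the
    supremum metric finite. *)
Lemma metrizes_min1 (X : uniformType) (d : X -> X -> R) :
  metrizes d -> metrizes (fun x y => Num.min (d x y) 1).
Proof.
move=> md; have [dm ent] := md; have [d0 dsym dtri] := dm.
have dge0 x y := metric_ge0 x y dm.
split; first split.
- move=> x y; rewrite -d0; split => [|->]; last by rewrite min_l.
  by rewrite minEle; case: leP => // _ /eqP; rewrite oner_eq0.
- by move=> x y; rewrite dsym.
- move=> x y z; move: (dge0 x y) (dge0 y z) (dtri x y z) => xy0 yz0 xyz.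
  by rewrite !minEle; case: (leP (d x z)) => ?; case: (leP (d x y)) => ?;
  case: (leP (d y z)) => ?; lra.
rewrite ent; apply/seteqP; split => E [e e0 eE].
- exists (Num.min e 1); first by rewrite /= lt_min e0 ltr01.
  move=> [x y] /=; rewrite lt_min !gt_min ltxx orbF => /andP[xye xy1].
  by apply: eE => /=; case/orP: xye => // e1; exact: lt_trans xy1 e1.
- exists e => // -[x y] /= xye; apply: eE => /=.
  by rewrite gt_min xye.
Qed.

Definition sup_metric (X Y : Type) (d : Y -> Y -> R) (f g : X -> Y) : R :=
  sup [set d (f x) (g x) | x in setT].

Section SupMetric.
Context {X Y : Type}.
Variable d : Y -> Y -> R.
Hypotheses (dm : is_metric d) (d1 : forall x y, d x y <= 1).
Implicit Types f g h : X -> Y.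

Lemma sup_metric_ge f g x : d (f x) (g x) <= sup_metric d f g.
Proof. by apply: ub_le_sup; [exists 1 => _ [y _ <-] | exists x]. Qed.

Lemma sup_metric_le f g c : 0 <= c -> (forall x, d (f x) (g x) <= c) ->
  sup_metric d f g <= c.
Proof.
move=> c0 fgc; rewrite /sup_metric; have [->|S0] := eqVneq [set d (f x) (g x) | x in setT] set0.
  by rewrite sup0.
by apply: ge_sup => [|_ [x _ <-]//]; exact/set0P.
Qed.

Lemma sup_metric_ge0 f g : 0 <= sup_metric d f g.
Proof.
have [[x]|nX] := pselect (inhabited X).
  exact: le_trans (metric_ge0 _ _ dm) (sup_metric_ge f g x).
rewrite /sup_metric [X in sup X](_ : _ = set0) ?sup0//.
by apply/seteqP; split => // t [x _ _]; apply: nX.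
Qed.

Lemma sup_metric_is_metric : is_metric (@sup_metric X Y d).
Proof.
case: (dm) => d0 dsym dtri; split.
- move=> f g; split => [fg|->].
    apply/funext => x; apply/d0; apply/eqP; rewrite eq_le metric_ge0// andbT.
    by rewrite -fg sup_metric_ge.
  apply/eqP; rewrite eq_le sup_metric_ge0 andbT.
  by apply: sup_metric_le => // x; rewrite metric_xx.
- by move=> f g; rewrite /sup_metric; under eq_fun do rewrite dsym.
- move=> f g h; apply: sup_metric_le => [|x].
    by apply: addr_ge0; exact: sup_metric_ge0.
  exact: le_trans (dtri _ (g x) _) (lerD (sup_metric_ge _ _ _) (sup_metric_ge _ _ _)).
Qed.

End SupMetric.

Lemma metrizes_uniform (X : choiceType) (Y : uniformType) (d : Y -> Y -> R) :
  metrizes d -> (forall x y, d x y <= 1) ->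
  metrizes (@sup_metric X Y d : {uniform X -> Y} -> {uniform X -> Y} -> R).
Proof.
move=> md d1; have [dm _] := md; split; first exact: sup_metric_is_metric.
rewrite uniform_entourage; apply/seteqP; split => E.
- move=> [F /(metrizes_entourageP _ md)[e e0 eF] FE]; exists e => //.
  move=> [f g] /= fge; apply: FE => x _; apply: eF => /=.
  exact: le_lt_trans (sup_metric_ge d1 f g x) fge.
- move=> [e /= e0 eE]; have e20 : 0 < e / 2 by lra.
  exists [set xy | d xy.1 xy.2 < e / 2].
    by apply/(metrizes_entourageP _ md); exists (e / 2).
  move=> [f g] /= fge; apply: eE => /=; apply: (@le_lt_trans _ _ (e / 2)); last lra.
  apply: sup_metric_le; first lra.
  by move=> x; exact/ltW/fge.
Qed.

Lemma metrizes_closedP (X : uniformType) (d : X -> X -> R) (A : set X) :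
  metrizes d ->
  closed A <->
  forall z, ~ A z -> exists2 e, 0 < e & forall a, A a -> e <= d z a.
Proof.
move=> md; split => [cA z nAz|sep z clz].
  apply: contrapT => nsep; apply: nAz; apply: cA => B /nbhsP[E entE EB].
  have [e e0 eE] := (metrizes_entourageP _ md).1 entE.
  apply: contrapT => nAB; apply: nsep; exists e => // a Aa.
  rewrite leNgt; apply/negP => zae; apply: nAB; exists a; split => //.
  by apply: EB; apply/xsectionP; exact: eE.
apply: contrapT => /sep[e e0 eA].
have : nbhs z (xsection [set xy | d xy.1 xy.2 < e] z).
  by apply: nbhs_entourage; apply/(metrizes_entourageP _ md); exists e.
by move=> /clz[a [Aa /xsectionP/=]]; rewrite ltNge eA.
Qed.

Lemma metrizes_norm (V : normedModType R) :
  metrizes (fun x y : V => `|x - y| : R).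
Proof.
split; first split.
- move=> x y; split => [/eqP|->]; last by rewrite subrr normr0.
  by rewrite normr_eq0 subr_eq0 => /eqP.
- by move=> x y; rewrite distrC.
- by move=> x y z; rewrite -[x - z](subrKA y) ler_normD.
by rewrite -(@entourage_ballE R); congr entourage_; rewrite -ball_normE.
Qed.

End Metrics.

(** * The punctured collar of a metric space *)

Section Collar.
Context {R : realType} {P : uniformType}.
Variable dP : P -> P -> R.
Hypotheses (mP : metrizes dP) (dP1 : forall p q, dP p q <= 1).

(** The coordinate [None] is the height over the functions on P. *)
Definition kuratowski (p : P) : option P -> R :=
  fun o => if o is Some q then dP p q else 0.

Definition collar : set {uniform option P -> R} :=
  [set f | f None != 0 \/ exists p, f = kuratowski p].

Definition near_kuratowski (e : R) (f : option P -> R) : Prop :=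
  exists p, forall o, `|kuratowski p o - f o| <= e.

Let dPm : is_metric dP. Proof. by case: mP. Qed.

Lemma dist_metric_le p p' q : `|dP p q - dP p' q| <= dP p p'.
Proof.
case: dPm => _ dsym dtri; have := dtri p p' q; have := dtri p' p q.
by rewrite (dsym p' p) ler_norml; lra.
Qed.

Let dR (x y : R) : R := Num.min `|x - y| 1.

Let mR : metrizes dR.
Proof. exact: (metrizes_min1 (metrizes_norm R^o)). Qed.

Let dR1 x y : dR x y <= 1. Proof. by rewrite /dR ge_min lexx orbT. Qed.

Let D (f g : (collar : Type)) : R := sup_metric dR (val f) (val g).

Let mD : metrizes D.
Proof. exact/metrizes_set_type/metrizes_uniform. Qed.

Let kuratowski_collar p : collar (kuratowski p).
Proof. by right; exists p. Qed.

Let kur (p : P) : (collar : Type) := SigSub (mem_set (kuratowski_collar p)).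

(** The supremum is attained at the coordinate q. *)
Let D_kur p q : D (kur p) (kur q) = dP p q.
Proof.
apply/eqP; rewrite eq_le; apply/andP; split.
  apply: sup_metric_le => [|[r|] /=]; first exact: metric_ge0.
    by rewrite /dR ge_min dist_metric_le.
  by rewrite /dR subrr normr0 min_l ?ler01// metric_ge0.
apply: le_trans (sup_metric_ge dR1 _ _ (Some q)).
rewrite /= /dR metric_xx// subr0 ger0_norm ?metric_ge0//.
by rewrite le_min lexx dP1.
Qed.

Let kur_inj : injective kur.
Proof.
move=> p q pq; case: dPm => d0 _ _; apply/d0; rewrite -D_kur pq.
by apply: metric_xx; case: mD.
Qed.

Let kur_embedding : uniform_embedding kur.
Proof.
split; first exact: kur_inj.
  apply/(metrizes_unif_continuousP _ mP mD) => e e0; exists e => // p q _ _.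
  by rewrite D_kur.
have kurE (y : (range kur : Type)) : exists p, kur p = val y.
  by have [p _ <-] := set_valP y; exists p.
exists (fun y => sval (cid (kurE y))) => [y|]; first by case: cid.
apply/(metrizes_unif_continuousP _ (metrizes_set_type _ mD) mP) => e e0.
by exists e => // x y _ _; do 2 case: cid => ? /= <-; rewrite D_kur.
Qed.

(** Off the image of P the height is nonzero, and the height is 1-Lipschitz. *)
Let kur_closed : closed (range kur).
Proof.
apply/(metrizes_closedP _ mD) => f nf.
have f0 : val f None != 0.
  case: (set_valP f) => // -[p fp]; exfalso; apply: nf; exists p => //.
  exact/val_inj/esym.
exists (Num.min `|val f None| 1); first by rewrite lt_min normr_gt0 f0 ltr01.
move=> _ [p _ <-]; apply: le_trans (sup_metric_ge dR1 _ _ None).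
by rewrite /dR /= subr0.
Qed.

(** The hypothesis on P, applied to the closed isometric copy of P in its collar
    and written for plain functions, so that no subtype appears later. *)
Lemma collar_retraction (pt : P) : uniform_ANR R P ->
  exists e (rho : (option P -> R) -> P),
  [/\ 0 < e, forall p, rho (kuratowski p) = p &
    forall eta, 0 < eta -> exists2 s, 0 < s & forall f g,
      collar f -> collar g -> near_kuratowski e f -> near_kuratowski e g ->
      (forall o, `|f o - g o| <= s) -> dP (rho f) (rho g) <= eta].
Proof.
move=> [_ /(_ _ _ _ mD kur_embedding kur_closed)[N [e e0 eN] [r [rc rid]]]].
(* Choosing the point of P by its relation to r makes rho total; the basepoint
   is the value far from P. *)
pose rho f := xget pt
  [set p | exists z : (N : Type), val (val z) = f /\ kur p = val (r z)].
have rhoE (z : (N : Type)) : kur (rho (val (val z))) = val (r z).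
  have [|z' [/val_inj/val_inj -> //]] := xgetPex pt (P :=
    [set p | exists z' : (N : Type), val (val z') = val (val z) /\
                                    kur p = val (r z')]).
  by have [p _ pr] := set_valP (r z); exists p, z.
have e20 : 0 < e / 2 by lra.
exists (e / 2), rho; split => //.
- move=> p.
  have Np : N (kur p).
    by apply: eN; exists (kur p); [exists p | rewrite D_kur metric_xx].
  apply: kur_inj; have := rhoE (SigSub (mem_set Np)) => /= ->.
  by rewrite rid//; exists p.
- move=> eta eta0.
  have /(_ eta eta0)[s s0 rs] := (metrizes_unif_continuousP r
    (metrizes_set_type _ mD) (metrizes_set_type _ mD)).1 rc.
  exists s => // f g Cf Cg.
  have lift h : collar h -> near_kuratowski (e / 2) h ->
      exists z : (N : Type), val (val z) = h.
    move=> Ch [p ph]; pose z : (collar : Type) := SigSub (mem_set Ch).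
    suff Nz : N z by exists (SigSub (mem_set Nz)).
    apply: eN; exists (kur p); first by exists p.
    apply: (@le_lt_trans _ _ (e / 2)); last lra.
    by apply: sup_metric_le => [|o]; [lra | rewrite /dR ge_min ph].
  move=> /(lift _ Cf)[z <-] /(lift _ Cg)[z' <-] zz'.
  rewrite -D_kur !rhoE; apply: rs => //.
  by apply: sup_metric_le => [|o]; [exact: ltW | rewrite /dR ge_min zz'].
Qed.

End Collar.

(** * Extension into the collar *)

Section Distance.
Context {R : realType} {Z : uniformType}.
Variables (d : Z -> Z -> R) (A : set Z).
Hypotheses (md : metrizes d) (A0 : A !=set0).

Definition dist_to (z : Z) : R := infimum A (d z).

Let dm : is_metric d. Proof. by case: md. Qed.
Let dge0 z : forall a, A a -> 0 <= d z a.
Proof. by move=> a _; exact: metric_ge0. Qed.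

Lemma dist_to_ge0 z : 0 <= dist_to z.
Proof. by apply: infimum_ge => //; exact: dge0. Qed.

Lemma dist_to_eq0 z : A z -> dist_to z = 0.
Proof.
move=> Az; apply/eqP; rewrite eq_le dist_to_ge0 andbT.
by apply: le_trans (infimum_le (dge0 z) Az) _; rewrite metric_xx.
Qed.

Lemma dist_to_gt0 z : closed A -> ~ A z -> 0 < dist_to z.
Proof.
move=> /(metrizes_closedP _ md) cA /cA[e e0 eA].
by apply: lt_le_trans e0 _; apply: infimum_ge.
Qed.

Lemma dist_to_lip z z' : `|dist_to z - dist_to z'| <= d z z'.
Proof.
case: dm => _ dsym dtri.
have sub x y : dist_to x <= dist_to y + d x y.
  by apply: (infimum_lip A0 (dge0 x)) => a _; rewrite addrC.
by have := sub z z'; have := sub z' z; rewrite (dsym z' z) ler_norml; lra.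
Qed.

End Distance.

Section CollarExtension.
Context {R : realType} {Z X P : uniformType}.
Variables (dZ : Z -> Z -> R) (dX : X -> X -> R) (dP : P -> P -> R).
Hypotheses (mZ : metrizes dZ) (mX : metrizes dX) (mP : metrizes dP).
Hypotheses (dX1 : forall x y, dX x y <= 1) (dP1 : forall p q, dP p q <= 1).
Variables (A : set Z) (s : X) (pt : P) (F : Z -> X -> P).
Hypotheses (A0 : A !=set0) (Aclosed : closed A).
Hypothesis F_unif_cont : forall e, 0 < e -> exists2 t, 0 < t &
  forall a b, A a -> A b -> dZ a b <= t -> forall x, dP (F a x) (F b x) <= e.
Hypothesis F_fiber : forall a, A a -> unif_cont_on dX dP setT (F a).
Hypothesis F_pointed : forall a, A a -> F a s = pt.

Let dZm : is_metric dZ. Proof. by case: mZ. Qed.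
Let dXm : is_metric dX. Proof. by case: mX. Qed.
Let dPm : is_metric dP. Proof. by case: mP. Qed.
Let X0 : [set: X] !=set0. Proof. by exists s. Qed.

(** The Kuratowski coordinates of F, first as a function of z with parameter
    (x, q). *)
Let dFP (z : Z) (xq : X * P) : R := dP (F z xq.1) xq.2.

Let dFP_unit : unit_valued A dFP.
Proof. by move=> a q _; rewrite metric_ge0// dP1. Qed.

Let dFP_cont : equi_unif_continuous_on dZ A dFP.
Proof.
move=> e /F_unif_cont[t t0 Ft]; exists t => // a b Aa Ab /(Ft a b Aa Ab) abe.
by move=> [x q]; exact: le_trans (dist_metric_le mP _ _ _) (abe x).
Qed.

(** Truncation restores the bound 1, which the second regularization needs. *)
Let ext (z : Z) (x : X) (q : P) : R :=
  Num.min (regularize dZ A dFP z (x, q)) 1.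

Let ext_unit z : unit_valued setT (ext z).
Proof.
move=> x q _; rewrite ge_min lexx orbT andbT le_min ler01 andbT.
exact: regularize_ge0.
Qed.

Let extE z x q : A z -> ext z x q = dP (F z x) q.
Proof. by move=> Az; rewrite /ext regularize_id// min_l//; exact: dP1. Qed.

Let ext_cont e : 0 < e -> exists2 t, 0 < t & forall z z', dZ z z' <= t ->
  forall x q, `|ext z x q - ext z' x q| <= e.
Proof.
move=> e0; have [t t0 dt] := regularize_continuous dZm A0 dFP_unit e0.
exists t => // z z' /dt zz' x q; have := zz' (x, q); rewrite /ext.
set u := regularize _ _ _ _ _; set v := regularize _ _ _ _ _.
rewrite !ler_norml !minEle => uv.
by case: (leP u 1) => ?; case: (leP v 1) => ?; lra.
Qed.

(** For each z, now as a function of x with parameter q. *)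
Let smooth z x q : R := regularize dX setT (ext z) x q.

Let smoothE z x q : A z -> smooth z x q = dP (F z x) q.
Proof.
move=> Az; rewrite /smooth regularize_id// ?extE//.
move=> e /(F_fiber Az)[t t0 Ft]; exists t => // a b _ _ /(Ft a b I I) abe p.
rewrite !extE//; have := dist_metric_le mP (F z a) (F z b) p.
by move=> /le_trans; apply.
Qed.

Let pointed z x q : R := smooth z x q - smooth z s q + dP pt q.

Let Phi z x (o : option P) : R :=
  if o is Some q then pointed z x q else dist_to dZ A z * dX x s.

Let PhiA a x : A a -> Phi a x = kuratowski dP (F a x).
Proof.
move=> Aa; apply/funext => -[q|] /=; last by rewrite dist_to_eq0// mul0r.
by rewrite /pointed !smoothE// F_pointed// addrNK.
Qed.

Let Phis z : Phi z s = kuratowski dP pt.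
Proof.
apply/funext => -[q|] /=; last by rewrite metric_xx// mulr0.
by rewrite /pointed subrr add0r.
Qed.

(** A uniformly continuous family of pointed maps over a closed set extends to
    the whole space when its values may move in the collar of P.  The height
    distinguishes the points over A from the others, and the factor d(x, s)
    keeps the basepoint fixed. *)
Lemma collar_extension : exists Phi : Z -> X -> option P -> R,
  [/\ forall z x, collar dP (Phi z x),
      forall a x, A a -> Phi a x = kuratowski dP (F a x),
      forall z, Phi z s = kuratowski dP pt,
      forall e, 0 < e -> exists2 t, 0 < t & forall z z', dZ z z' <= t ->
        forall x o, `|Phi z x o - Phi z' x o| <= e &
      forall z e, 0 < e -> exists2 t, 0 < t & forall x x', dX x x' <= t ->
        forall o, `|Phi z x o - Phi z x' o| <= e].
Proof.
exists Phi; split => //.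
- move=> z x; have [Az|nAz] := pselect (A z).
    by right; exists (F z x); exact: PhiA.
  have [->|xs] := eqVneq x s; first by right; exists pt; exact: Phis.
  (* Off A, which is closed, and off s the height is positive. *)
  left; rewrite /= mulf_neq0//; first by rewrite gt_eqF// dist_to_gt0.
  by apply: contra_neq xs; case: dXm => /(_ x s)[].
- (* The regularized functions at x and at s each contribute 5 (e / 10). *)
  move=> e e0; have e100 : 0 < e / 10 by lra.
  have [t t0 extt] := ext_cont e100.
  exists (Num.min t e) => [|z z']; first by rewrite lt_min t0 e0.
  rewrite le_min => /andP[/extt zz' zz'e] x [q|] /=.
    have e100' := ltW e100.
    have sm y : `|smooth z y q - smooth z' y q| <= 5 * (e / 10).
      by apply: (regularize_lip dXm X0) => // *; exact: zz'.
    rewrite /pointed; move: (sm x) (sm s).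
    move: (smooth z x q) (smooth z' x q) (smooth z s q) (smooth z' s q).
    by move=> a b a' b'; rewrite !ler_norml; lra.
  rewrite -mulrBl normrM [`|dX x s|]ger0_norm ?metric_ge0//.
  apply: le_trans zz'e; apply: le_trans (dist_to_lip mZ A0 z z').
  by rewrite ler_piMr.
- (* The height is h-Lipschitz in x; adding 1 makes h invertible. *)
  move=> z e e0; pose h := dist_to dZ A z + 1.
  have h0 : 0 < h by rewrite ltr_wpDl// dist_to_ge0.
  have [t t0 zt] := regularize_continuous dXm X0 (ext_unit z) e0.
  exists (Num.min t (e / h)) => [|x x']; first by rewrite lt_min t0 divr_gt0.
  rewrite le_min => /andP[/zt xx' xx'e] [q|] /=.
    have -> : pointed z x q - pointed z x' q = smooth z x q - smooth z x' q.
      rewrite /pointed; move: (smooth z x q) (smooth z x' q) (smooth z s q).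
      by move=> a b c; lra.
    exact: xx'.
  rewrite -mulrBr normrM ger0_norm ?dist_to_ge0//.
  apply: (@le_trans _ _ (h * (e / h))); last by rewrite mulrC divfK// gt_eqF.
  apply: ler_pM => //; first exact: dist_to_ge0.
    by rewrite lerDl.
  by apply: le_trans (dist_metric_le mX _ _ _) xx'e.
Qed.

End CollarExtension.

(** * Spaces of pointed maps *)

(** The retraction sends z to rho o Phi z, for Phi extending the inverse G of the
    embedding and rho the retraction of the collar; the radius t of the
    neighborhood keeps Phi z x in the domain of rho for all x at once. *)
Theorem pointed_maps_uniform_ANR (R : realType) (X P : uniformType) (s : X)
    (pt : P) :
  metrizable R X -> uniform_ANR R P ->
  uniform_ANR R (pointed_maps s pt : Type).
Proof.
move=> [dX0 mX0] ANRP; have [[dP0 mP0] _] := ANRP.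
have min1 (T : Type) (d : T -> T -> R) x y : Num.min (d x y) 1 <= 1.
  by rewrite ge_min lexx orbT.
have mX := metrizes_min1 mX0; have dX1 := min1 _ dX0.
have mP := metrizes_min1 mP0; have dP1 := min1 _ dP0.
set dX := fun x y => _ in mX; set dP := fun x y => _ in mP.
pose Y : uniformType := (pointed_maps s pt : Type).
pose dY (f g : Y) : R := sup_metric dP (val f) (val g).
have mY : metrizes dY by exact/metrizes_set_type/metrizes_uniform.
split; first by exists dY.
move=> Z dZ i mZ [iinj iuc [g gK guc]] Aclosed; set A := range i in Aclosed *.
have [dPm _] := mP; have [dYm _] := mY.
have Ypt : pointed_maps s pt (fun _ : X => pt).
  split => //; apply/(metrizes_unif_continuousP _ mX mP) => e e0; exists e => //.
  by move=> *; rewrite metric_xx// ltW.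
pose y0 : Y := SigSub (mem_set Ypt).
(* The inverse of i, extended to Z by an arbitrary value. *)
pose G (z : Z) : Y := xget y0 [set y | i y = z].
have GK y : G (i y) = y.
  by apply: iinj; apply: (xgetPex y0 (P := [set y' | i y' = i y])); exists y.
have gG (a : (A : Type)) : g a = G (val a) by rewrite -gK GK.
have Guc : unif_cont_on dZ dY A G.
  move=> e e0; have /(_ e e0)[t t0 gt] := (metrizes_unif_continuousP g
    (metrizes_set_type _ mZ) mY).1 guc.
  exists t => // a b Aa Ab ab.
  have := gt (SigSub (mem_set Aa)) (SigSub (mem_set Ab)) I I ab.
  by rewrite !gG.
have GP y : pointed_maps s pt (val (G y)) by exact: set_valP.
have [|//||||Phi [Phi_collar PhiA Phis Phi_z Phi_x]] := @collar_extension
  R Z X P dZ dX dP mZ mX mP dX1 dP1 A s pt (fun z => val (G z) : X -> P).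
- by exists (i y0), y0.
- move=> e /Guc[t t0 Gt]; exists t => // a b Aa Ab /(Gt a b Aa Ab) abe x.
  exact: le_trans (sup_metric_ge dP1 _ _ x) abe.
- by move=> a _; apply/(metrizes_unif_continuousP _ mX mP); case: (GP a).
- by move=> a _; case: (GP a).
have [e [rho [e0 rhoK rho_uc]]] := collar_retraction mP dP1 pt ANRP.
have [t t0 Phi_t] := Phi_z e e0.
pose N := eps_neighborhood dZ A t.
have Phi_near z x : N z -> near_kuratowski dP e (Phi z x).
  move=> [a Aa /ltW az]; exists (val (G a) x) => o.
  by rewrite -(PhiA a x Aa); exact: Phi_t.
pose H z x := rho (Phi z x).
have HP z : N z -> pointed_maps s pt (H z).
  move=> Nz; split; last by rewrite /H Phis rhoK.
  apply/(metrizes_unif_continuousP _ mX mP) => eta /rho_uc[u u0 rho_u].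
  have [v v0 Phi_v] := Phi_x z u u0; exists v => // x x' _ _ /Phi_v xx'.
  by apply: rho_u => //; exact: Phi_near.
pose toY (z : (N : Type)) : Y := SigSub (mem_set (HP (val z) (set_valP z))).
have iA y : A (i y) by exists y.
exists N; first by exists t.
exists (fun z => SigSub (mem_set (iA (toY z)))); split; last first.
  (* On A, the map H z is G z. *)
  move=> z [y _ yz] /=; rewrite -yz; congr i; apply: val_inj.
  rewrite /= /H -yz; apply/funext => x; rewrite PhiA//.
  by rewrite GK rhoK.
apply/(metrizes_unif_continuousP _ (metrizes_set_type _ mZ)
  (metrizes_set_type _ mZ)) => eta eta0.
have /(_ eta eta0)[u u0 iu] := (metrizes_unif_continuousP i mY mZ).1 iuc.
have [v v0 rho_v] := rho_uc u u0; have [w w0 Phi_w] := Phi_z v v0.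
exists w => // z z' _ _ /Phi_w zz'; apply: iu => //.
apply: sup_metric_le => [|x]; first exact: ltW.
by apply: rho_v => //; apply: Phi_near; exact: set_valP.
Qed.

Lemma sphere_metrizable (R : realType) (n : nat) :
  metrizable R (sphere R n : Type).
Proof.
by eexists; exact: (metrizes_set_type (sphere R n) (metrizes_norm 'rV[R]_n.+1)).
Qed.

Theorem corollary14p6 (R : realType) (P : uniformType) (pt : P) :
  uniform_ANR R P ->
  forall (n : nat) (s : sphere R n),
    uniform_ANR R (iterated_loop_space s pt).
Proof.
move=> ANRP n s.
exact: pointed_maps_uniform_ANR (sphere_metrizable R n) ANRP.
Qed.
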